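(* Let $H=(V,F)$ be a graph with $m\geq 1$ edges (that is, $H\neq\emptyset$). Then for some integer $1\leq t\leq m$ there exist reals $a_1\leq\cdots\leq a_t$, which are the critical roots of $H$, possibly with multiplicities (i.e. the set $\{a_1,\dots,a_t\}$ is the set of critical roots of $H$), decomposing the real line into the intervals $$C_0:=(-\infty,a_1],\quad C_1:=[a_1,a_2],\quad\dots,\quad C_{t-1}:=[a_{t-1},a_t],\quad C_t:=[a_t,\infty),$$ integers $m=e_0>e_1>\cdots>e_t=0$, and subgraphs $H=G_{e_0},G_{e_1},\dots,G_{e_t}=\emptyset$ of $H$, such that, for $i=0,\dots,t$, the subgraph $G_{e_i}$ has $e_i$ edges and is optimal for QDSO over $H$ and any $a\in C_i$. The optimal value $f^*(H,a)$ of QDSO is convex piecewise affine in $a$ with the $C_i$ as its pieces. Moreover, letting $O_i$ be the open interval which is the interior of $C_i$ for $i=0,\dots,t$, we have, for each $i$: 1. For every $a\in C_i$: $f^*(H,a)=s_{e_i}(H)-2e_i a$, and any $\mathrm{SDS}_{e_i}$-optimal subgraph $G\subseteq H$ is also QDSO-optimal (for this $a$). 2. For every $a\in O_i$: any QDSO-optimal subgraph $G\subseteq H$ (for this $a$) has $e_i$ edges, and is also $\mathrm{SDS}_{e_i}$-optimal.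
   Context: Graphs are finite and simple. A subgraph $G\subseteq H$ of $H=(V,F)$ always means a graph $G=(V,E)$ with the same vertex set $V$ and $E\subseteq F$; $\emptyset$ denotes the empty subgraph $(V,\emptyset)$; $d_v(G)$ is the degree of $v$ in $G$. QDSO over $H$ with real number $a$ is the problem of finding $G\subseteq H$ attaining $$f^*(H,a):=\max\Big\{\sum_{v\in V}d_v(G)\big(d_v(G)-a\big)\ :\ G\subseteq H\Big\}.$$ A maximizer is called QDSO-optimal (for $a$). For $e=0,\dots,m$, where $m=|F|$, $\mathrm{SDS}_e$ is the problem of finding a subgraph attaining $$s_e(H):=\max\Big\{\sum_{v\in V}d_v(G)^2\ :\ G=(V,E)\subseteq H,\ |E|=e\Big\}.$$ A maximizer is called $\mathrm{SDS}_e$-optimal. A critical root of $H$ is a real number $a$ such that QDSO over $H$ and $a$ has optimal subgraphs $G_1=(V,E_1)$ and $G_2=(V,E_2)$ with $|E_1|\neq|E_2|$. Since the $a_i$ may coincide, some of the intervals $C_i$ may be degenerate (single points), in which case $O_i=\emptyset$. *)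

(* Defs.v *)
From HB Require Import structures.
From mathcomp Require Import all_boot all_order all_algebra.
From mathcomp Require Import all_classical all_reals all_analysis.

Set Implicit Arguments.
Unset Strict Implicit.
Unset Printing Implicit Defensive.

Import Order.TTheory GRing.Theory Num.Theory.
Import numFieldNormedType.Exports.

Local Open Scope ring_scope.

(* A graph on the vertex set V is given by its set of edges, each edge being
   the set of its two endpoints. As subgraphs keep all the vertices, they are
   subsets of the edge set, and the empty subgraph is [finset.set0]. *)
Notation edge_set V := {set {set V}}.

Definition simple_graph (V : finType) (H : edge_set V) : bool :=
  [forall f in H, #|f| == 2%N].

Definition deg (V : finType) (G : edge_set V) (v : V) : nat :=
  #|[set f in G | v \in f]|.

Section Problems.
Context {R : realType} {V : finType}.
Implicit Types (H G : edge_set V) (a : R).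

Definition qdso_value a G : R :=
  \sum_(v : V) (deg G v)%:R * ((deg G v)%:R - a).

(* The empty subgraph is always feasible, so its value may serve as the
   starting point of the maximum. *)
Definition qdso_max H a : R :=
  \big[Num.max/qdso_value a finset.set0]_(G : edge_set V | G \subset H)
    qdso_value a G.

Definition qdso_optimal H a G : Prop :=
  G \subset H /\ qdso_value a G = qdso_max H a.

Definition sds_value G : nat := (\sum_(v : V) deg G v ^ 2)%N.

(* Only meaningful for e <= #|H|; otherwise there is no feasible subgraph. *)
Definition sds_max H (e : nat) : nat :=
  (\max_(G : edge_set V | (G \subset H) && (#|G| == e)) sds_value G)%N.

Definition sds_optimal H (e : nat) G : Prop :=
  [/\ G \subset H, #|G| = e & sds_value G = sds_max H e].

Definition critical_root H a : Prop :=
  exists G1 G2, [/\ qdso_optimal H a G1, qdso_optimal H a G2 & #|G1| <> #|G2|].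

End Problems.

(* The i-th of the t + 1 closed intervals, i = 0, ..., t, into which the points
   a 1 <= ... <= a t cut the line (a 0 is not used). *)
Definition piece {R : realType} (t : nat) (a : nat -> R) (i : nat) : set R :=
  [set` Interval (if i == 0%N then -oo%O else BLeft (a i))
                 (if i == t then +oo%O else BRight (a i.+1))].

(* The sets C 0, ..., C t cover the line, and f is affine on each of them, with
   a different slope for each. (On a single point the slope is arbitrary.) *)
Definition piecewise_affine {R : realType} (f : R -> R) (t : nat)
    (C : nat -> set R) : Prop :=
  (forall x : R, exists2 i, (i <= t)%N & C i x) /\
  exists p q : nat -> R,
    (forall i x, (i <= t)%N -> C i x -> f x = p i * x + q i) /\
    (forall i j, (i <= t)%N -> (j <= t)%N -> p i = p j -> i = j).

(* Main.v *)
Require Import Defs.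
From HB Require Import structures.
From mathcomp Require Import all_boot all_order all_algebra.
From mathcomp Require Import all_classical all_reals all_analysis.
From mathcomp Require Import ring lra zify.
Set Implicit Arguments.
Unset Strict Implicit.
Unset Printing Implicit Defensive.

Import Order.TTheory GRing.Theory Num.Theory.
Import numFieldNormedType.Exports.
Local Open Scope classical_set_scope.
Local Open Scope ring_scope.

(** Every subgraph K of H satisfies sum_v d_v(K) = 2 |K|, so its QDSO value at
    x is sds_value K - 2 |K| x: an affine function of x whose slope depends on
    the number of edges only. Among the subgraphs with k edges the best one is
    therefore the same for all x, namely an SDS_k-optimal one, and the QDSO
    optimum is the upper envelope of the m + 1 lines s_k - 2 k x, where
    0 <= k <= m. This makes it convex.

    As x runs from -oo to +oo, the envelope follows lines of smaller and
    smaller k: line m first, since it is the steepest one, and line 0 last.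
    The lines e_0 > ... > e_t that it follows and the points a_i where it
    changes line are what [upper_envelope] provides. The subgraphs G_i are
    SDS-optimal subgraphs with e_i edges; G_0 = H and G_t is empty by
    cardinality.

    All the uniqueness claims come from one remark ([touching_lines_eq]): a
    line below another one near x, and meeting it at x, has the same slope.
    Hence inside the i-th piece only subgraphs with e_i edges are optimal, and
    so a critical root must be an endpoint. Conversely every a_i belongs to
    the two pieces that it separates, even when these are single points, so
    that G_(i-1) and G_i, whose sizes differ, are both optimal there. *)

(** * The intervals cut out by the points a_i *)

Lemma pieceP (R : realType) (t : nat) (a : nat -> R) (i : nat) (x : R) :
    (i <= t)%N ->
  piece t a i x <->
    ((0 < i)%N -> a i <= x) /\ ((i < t)%N -> x <= a i.+1).
Proof.
move=> i_le_t; rewrite /piece /= in_itv /= [(i < t)%N]ltn_neqAle i_le_t lt0n.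
case: (i == 0)%N; case: (i == t)%N; rewrite /= ?andbT; split=> //.
- by case=> _; apply.
- by case=> ->.
- by move=> /andP[].
- by case=> -> // ->.
Qed.

Lemma interior_pieceP (R : realType) (t : nat) (a : nat -> R) (i : nat)
    (x : R) : (i <= t)%N ->
  (piece t a i)° x <->
    ((0 < i)%N -> a i < x) /\ ((i < t)%N -> x < a i.+1).
Proof.
move=> i_le_t; rewrite /piece [(i < t)%N]ltn_neqAle i_le_t lt0n.
case: (i == 0)%N; case: (i == t)%N; rewrite interior_itv /= in_itv /= ?andbT;
  split=> //.
- by case=> _; apply.
- by case=> ->.
- by move=> /andP[].
- by case=> -> // ->.
Qed.

(** The largest i <= t such that i = 0 or a_i <= x works. *)
Lemma piece_cover (R : realType) (t : nat) (a : nat -> R) (x : R) :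
  exists2 i, (i <= t)%N & piece t a i x.
Proof.
pose P i := (i <= t)%N && ((i == 0)%N || (a i <= x)).
have exP : exists i, P i by exists 0%N.
have Pt i : P i -> (i <= t)%N by case/andP.
case: (ex_maxnP exP Pt) => i /andP[it ai] maxi; exists i => //.
apply/pieceP => //; split=> [|lt_it].
  by rewrite lt0n => /negPf i0; rewrite i0 in ai.
rewrite leNgt; apply/negP => /ltW ax.
by have := maxi i.+1; rewrite /P lt_it ax ltnn => /(_ isT).
Qed.

Lemma left_endpoint_piece (R : realType) (t : nat) (a : nat -> R) (i : nat) :
    (forall j, (1 <= j < t)%N -> a j <= a j.+1) -> (0 < i <= t)%N ->
  piece t a i (a i).
Proof.
by move=> a_ndecr /andP[i0 it]; apply/pieceP => //; split=> // lt_it;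
  apply: a_ndecr; rewrite i0.
Qed.

Lemma right_endpoint_piece (R : realType) (t : nat) (a : nat -> R) (i : nat) :
    (forall j, (1 <= j < t)%N -> a j <= a j.+1) -> (i < t)%N ->
  piece t a i (a i.+1).
Proof.
move=> a_ndecr it; apply/pieceP; first exact: ltnW.
by split=> // i0; apply: a_ndecr; rewrite i0.
Qed.

(** * Upper envelopes of lines *)

(** Induction on the steepest line m. Line m is the envelope up to the first
    point c where another line k < m meets it. Beyond c the lines strictly
    between k and m, and line m itself, stay below line k, because they do not
    exceed it at c and they are steeper. So there the envelope is that of the
    lines 0, ..., k, given by the induction hypothesis and cut at c. If
    several lines meet line m at c, any of them may play the role of k: this
    merely yields repeated points a_i. *)
Lemma upper_envelope (R : realType) (p b : nat -> R) (m : nat) :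
    {homo p : j k / (j < k)%N >-> j < k} ->
  exists (t : nat) (a : nat -> R) (e : nat -> nat),
    [/\ (t <= m)%N,
        forall i, (1 <= i < t)%N -> a i <= a i.+1,
        e 0%N = m, e t = 0%N &
        forall i, (i < t)%N -> (e i.+1 < e i)%N] /\
    forall i k x, (i <= t)%N -> (k <= m)%N -> piece t a i x ->
      b k - p k * x <= b (e i) - p (e i) * x.
Proof.
move=> p_incr; elim/ltn_ind: m => -[_|m IH].
  exists 0%N, (fun=> 0), (fun=> 0%N); split; first by split=> // i; lia.
  by move=> i k x _; rewrite leqn0 => /eqP->.
pose cross (k : 'I_m.+1) := (b m.+1 - b k) / (p m.+1 - p k).
have crossE (k : 'I_m.+1) x :
    (b k - p k * x <= b m.+1 - p m.+1 * x) = (x <= cross k).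
  by rewrite ler_pdivlMr ?subr_gt0 ?p_incr //; apply/idP/idP; lra.
have crossE' (k : 'I_m.+1) :
    b k - p k * cross k = b m.+1 - p m.+1 * cross k.
  have : cross k * (p m.+1 - p k) = b m.+1 - b k.
    by rewrite divfK // subr_eq0 gt_eqF ?p_incr.
  lra.
have [k _ kmin] := @arg_minP _ _ _ (ord0 : 'I_m.+1) xpredT cross isT.
set c := cross k in kmin.
have top_c j : (j <= m.+1)%N -> b j - p j * c <= b k - p k * c.
  rewrite leq_eqVlt => /predU1P[->|jm]; first by rewrite crossE'.
  by rewrite crossE' (crossE (Ordinal jm)) kmin.
have [t [a [e [[tk a_ndecr e0 et e_decr] env]]]] := IH k (ltn_ord k).
(* At a_1 the line k meets the line e_1, which is less steep and would thus be
   above line k at c if a_1 < c. *)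
have c_le_a1 : (0 < t)%N -> c <= a 1%N.
  move=> t0; rewrite leNgt; apply/negP => a1_lt_c.
  have k_max := env 0%N k _ (leq0n t) (leqnn k)
    (right_endpoint_piece a_ndecr t0).
  have e1_max := env 1%N k _ t0 (leqnn k)
    (left_endpoint_piece a_ndecr (t0 : (0 < 1 <= t)%N)).
  have e1k : (e 1%N < k)%N by rewrite -e0 e_decr.
  have := top_c (e 1%N) (ltnW (ltn_trans e1k (ltn_ord k))).
  have := p_incr _ _ e1k; nra.
exists t.+1, (fun i => if (i <= 1)%N then c else a i.-1),
  (fun i => if i is i'.+1 then e i' else m.+1).
split.
  split=> //; first by rewrite ltnS (leq_trans tk) // -ltnS.
  - by case=> [|[|i]] //= it; apply: a_ndecr; lia.
  - by case=> [|i] /= it; [rewrite e0|apply: e_decr].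
move=> [|i] j x it jm /pieceP => /(_ it) /= [xl xr].
  move: jm; rewrite leq_eqVlt => /predU1P[->//|jm].
  by rewrite (crossE (Ordinal jm)) (le_trans (xr isT)) ?kmin.
have c_le_x : c <= x.
  case: i xl {xr} it => [|i] /(_ isT) //= ax it.
  apply: le_trans (c_le_a1 _) (le_trans _ ax) => //; first by lia.
  elim: i {ax} it => [//|i IHi] it.
  by apply: le_trans (IHi _) (a_ndecr _ _); lia.
have xa : piece t a i x.
  apply/pieceP => //; split=> [i0|i_t]; last exact: xr.
  by case: (i) i0 xl => //= ? _; exact.
have [jk|kj] := leqP j k; first exact: env.
apply: le_trans (env i k x _ _ xa) => //.
have := top_c j jm; have := p_incr _ _ kj; nra.
Qed.

(** Compare the two lines at x + d and at x - d for a small d > 0: the former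
    gives one inequality between the slopes, the latter the other one. *)
Lemma touching_lines_eq (R : realType) (A : set R) (b b' p p' x : R) :
    A° x -> (forall y, A y -> b - p * y <= b' - p' * y) ->
  b - p * x = b' - p' * x -> p = p'.
Proof.
move=> /nbhs_ballP[d /= d0 ballA] below eq_x.
have in_A y : `|x - y| < d -> b - p * y <= b' - p' * y by move=> /ballA/below.
have d20 : 0 < d / 2 by rewrite divr_gt0.
have d2d : d / 2 < d by lra.
have : b - p * (x + d / 2) <= b' - p' * (x + d / 2).
  by apply: in_A; rewrite distrC addrC addKr gtr0_norm.
have : b - p * (x - d / 2) <= b' - p' * (x - d / 2).
  by apply: in_A; rewrite subKr gtr0_norm.
move=> le1 le2.
by apply/eqP; rewrite eq_le; apply/andP; split;
  rewrite -(ler_pM2r d20); lra.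
Qed.

(** * Degree sums and optimal subgraphs *)

Lemma deg_sum_edges (V : finType) (K : edge_set V) :
  (\sum_(v : V) deg K v = \sum_(f in K) #|f|)%N.
Proof.
transitivity (\sum_(v : V) \sum_(f in K) (v \in f))%N.
  apply: eq_bigr => v _; rewrite /deg -sum1_card big_mkcond [RHS]big_mkcond /=.
  by apply: eq_bigr => f _; rewrite inE; case: (f \in K); case: (v \in f).
rewrite exchange_big; apply: eq_bigr => f _ /=.
by rewrite -sum1_card [RHS]big_mkcond; apply: eq_bigr => v _; case: (v \in f).
Qed.

Section EdgeSets.
Context {R : realType} {V : finType} (H : edge_set V).
Implicit Types (K : edge_set V) (x : R).

(** By the handshake identity, the value depends on x only through |K|. *)
Lemma qdso_valueE K x : simple_graph K ->
  qdso_value x K = (sds_value K)%:R - 2 * #|K|%:R * x.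
Proof.
move=> /forall_inP simpleK.
have handshake : (\sum_(v : V) deg K v = 2 * #|K|)%N.
  rewrite deg_sum_edges (eq_bigr (fun=> 2%N)) => [|f /simpleK/eqP//].
  by rewrite sum_nat_const mulnC.
rewrite -natrM -handshake !natr_sum mulr_suml -sumrB.
by apply: eq_bigr => v _; rewrite natrX; ring.
Qed.

Lemma qdso_optimalP K x :
  qdso_optimal H x K <->
    K \subset H /\
    forall L : edge_set V, L \subset H -> qdso_value x L <= qdso_value x K.
Proof.
split=> -[KH opt]; split=> //.
  by move=> L LH; rewrite opt; apply: le_bigmax_cond.
apply/eqP; rewrite eq_le le_bigmax_cond //=.
by apply: bigmax_le => [|L LH]; apply: opt; rewrite ?finset.sub0set.
Qed.

Lemma sds_value_le_max K : K \subset H -> (sds_value K <= sds_max H #|K|)%N.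
Proof. by move=> KH; apply: leq_bigmax_cond; rewrite KH eqxx. Qed.

Lemma sds_optimal_exists e :
  (e <= #|H|)%N -> exists K : edge_set V, sds_optimal H e K.
Proof.
move=> eH.
pose feasible := [pred K : edge_set V | (K \subset H) && (#|K| == e)].
have : (0 < #|feasible|)%N by rewrite -cardsE cards_draws bin_gt0.
move=> /(eq_bigmax_cond (fun K => sds_value K))[K /andP[KH /eqP Ke] optK].
by exists K; split.
Qed.

(** * The optimal value as an envelope of lines *)

Lemma qdso_value_conv K (c x y : R) :
  qdso_value (c * x + (1 - c) * y) K =
    c * qdso_value x K + (1 - c) * qdso_value y K.
Proof.
by rewrite !mulr_sumr -big_split; apply: eq_bigr => v _ /=; ring.
Qed.

Lemma qdso_max_convex : convex_function [set: R^o] (qdso_max H : R^o -> R^o).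
Proof.
move=> c x y _ _ /=; rewrite !convRE /unstable.onem.
have le_max z K : K \subset H -> qdso_value z K <= qdso_max H z.
  by move=> KH; apply: le_bigmax_cond.
apply: bigmax_le => [|K KH]; rewrite qdso_value_conv;
  by apply: lerD; rewrite ler_wpM2l ?subr_ge0 ?le_max ?finset.sub0set.
Qed.

Hypothesis simpleH : simple_graph H.

Lemma simple_subgraph K : K \subset H -> simple_graph K.
Proof.
move=> /fintype.subsetP KH; apply/forall_inP => f /KH.
by move/forall_inP: simpleH; apply.
Qed.

Let line (k : nat) x : R := (sds_max H k)%:R - 2 * k%:R * x.

Lemma qdso_value_le_line K x : K \subset H -> qdso_value x K <= line #|K| x.
Proof.
move=> KH; rewrite qdso_valueE ?simple_subgraph //.
by rewrite lerD2r ler_nat sds_value_le_max.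
Qed.

(** In what follows A stands for one of the pieces, over which the line of
    SDS_e dominates all the other ones. *)
Section Piece.
Variables (e : nat) (A : set R).
Hypothesis e_le : (e <= #|H|)%N.
Hypothesis line_top :
  forall k x, (k <= #|H|)%N -> A x -> line k x <= line e x.

Lemma sds_optimal_qdso_optimal K x :
  A x -> sds_optimal H e K -> qdso_optimal H x K.
Proof.
move=> Ax [KH Ke optK]; apply/qdso_optimalP; split=> // L LH.
apply: le_trans (qdso_value_le_line x LH) _.
apply: le_trans (line_top (subset_leq_card LH) Ax) _.
by rewrite qdso_valueE ?simple_subgraph // Ke optK.
Qed.

Lemma qdso_max_line x : A x -> qdso_max H x = line e x.
Proof.
move=> Ax; have [K optK] := sds_optimal_exists e_le.
have [KH <-] := sds_optimal_qdso_optimal Ax optK.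
by case: optK => _ Ke optK; rewrite qdso_valueE ?simple_subgraph // Ke optK.
Qed.

(** An optimal K at x lies between the line of SDS_|K| and the dominating line,
    so these two meet at x and K attains both. Meeting in the interior forces
    |K| = e. *)
Lemma interior_qdso_optimal K x :
  A° x -> qdso_optimal H x K -> sds_optimal H e K.
Proof.
move=> intx [KH optK]; have Ax := interior_subset intx.
have value_e : qdso_value x K = line e x by rewrite optK qdso_max_line.
have KleH := subset_leq_card KH.
have line_x : line #|K| x = line e x.
  by apply/eqP; rewrite eq_le line_top //= -value_e qdso_value_le_line.
have /(mulfI _) : 2 * #|K|%:R = 2 * e%:R :> R.
  exact: touching_lines_eq intx (fun y Ay => line_top KleH Ay) line_x.
move=> /(_ _)/eqP; rewrite ?pnatr_eq0 // eqr_nat => /(_ isT)/eqP Ke.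
split=> //; apply/eqP; rewrite -(eqr_nat R); apply/eqP.
by move: value_e; rewrite qdso_valueE ?simple_subgraph // Ke => /addIr.
Qed.

End Piece.

End EdgeSets.

Unset Implicit Arguments.

Theorem theorem4p2 (R : realType) (V : finType) (H : edge_set V)
    (simpleH : simple_graph H) (H_gt0 : (1 <= #|H|)%N) :
  exists (t : nat) (a : nat -> R) (e : nat -> nat) (G : nat -> edge_set V),
    (1 <= t <= #|H|)%N /\
    (forall i, (1 <= i < t)%N -> a i <= a i.+1) /\
    (forall x : R, critical_root H x <-> exists2 i, (1 <= i <= t)%N & x = a i) /\
    e 0%N = #|H| /\ e t = 0%N /\ (forall i, (i < t)%N -> (e i.+1 < e i)%N) /\
    G 0%N = H /\ G t = finset.set0 /\
    (forall i, (i <= t)%N ->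
       [/\ G i \subset H, #|G i| = e i &
           forall x : R, piece t a i x -> qdso_optimal H x (G i)]) /\
    convex_function [set: R^o] (qdso_max H : R^o -> R^o) /\
    piecewise_affine (qdso_max H) t (piece t a) /\
    (forall i, (i <= t)%N ->
       (forall x : R, piece t a i x ->
          qdso_max H x = (sds_max H (e i))%:R - 2 * (e i)%:R * x /\
          forall K : edge_set V, sds_optimal H (e i) K -> qdso_optimal H x K) /\
       (forall x : R, (piece t a i)° x ->
          forall K : edge_set V, qdso_optimal H x K ->
            #|K| = e i /\ sds_optimal H (e i) K)).
Proof.
have slope_incr :
    {homo (fun k : nat => 2 * k%:R : R) : j k / (j < k)%N >-> j < k}.
  by move=> j k jk; rewrite ltr_pM2l ?ltr0n // ltr_nat.
have [t [a [e [[tm a_ndecr e0 et e_decr] env]]]] :=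
  upper_envelope (fun k => (sds_max H k)%:R) #|H| slope_incr.
have e_le i : (i <= t)%N -> (e i <= #|H|)%N.
  elim: i => [|i IH] it; first by rewrite e0.
  exact: leq_trans (ltnW (e_decr i it)) (IH (ltnW it)).
have e_decr2 i j : (i < j <= t)%N -> (e j < e i)%N.
  case/andP; elim: j => [//|j IH]; rewrite ltnS leq_eqVlt => /predU1P[->|ij] jt.
    exact: e_decr.
  exact: ltn_trans (e_decr j jt) (IH ij (ltnW jt)).
have t0 : (0 < t)%N.
  by rewrite lt0n; apply/eqP => tz; move: H_gt0; rewrite -e0 -tz et.
have top i it k x kH := env i k x it kH.
have [G optG] : exists G : nat -> edge_set V,
    forall i, (i <= t)%N -> sds_optimal H (e i) (G i).
  have /choice[G optG] :
      forall i, exists K, (i <= t)%N -> sds_optimal H (e i) K.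
    move=> i; have [it|ti] := leqP i t; last by exists finset.set0.
    by have [K optK] := sds_optimal_exists (e_le i it); exists K.
  by exists G.
have qdsoG i x : (i <= t)%N -> piece t a i x -> qdso_optimal H x (G i).
  move=> it ax; apply: (sds_optimal_qdso_optimal simpleH (top i it)) => //.
  exact: optG.
have cardG i : (i <= t)%N -> #|G i| = e i by move=> /optG[].
have value_line i x : (i <= t)%N -> piece t a i x ->
    qdso_max H x = (sds_max H (e i))%:R - 2 * (e i)%:R * x.
  by move=> it; apply: qdso_max_line; [exact: simpleH|exact: e_le|exact: top].
have int_opt i x K : (i <= t)%N -> (piece t a i)° x -> qdso_optimal H x K ->
    sds_optimal H (e i) K.
  by move=> it; apply: interior_qdso_optimal;
    [exact: simpleH|exact: e_le|exact: top].
exists t, a, e, G; split; first by rewrite t0.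
split; first exact: a_ndecr.
split.
  move=> x; split.
    (* A root that is no endpoint would lie inside a piece. *)
    move=> [K1 [K2 [opt1 opt2 neqK]]]; apply: contrapT => not_end.
    have [i it ax] := piece_cover t a x.
    have intx : (piece t a i)° x.
      have [xl xr] := (pieceP a x it).1 ax.
      apply/(interior_pieceP _ _ it); split=> i_t.
        rewrite lt_neqAle xl // andbT; apply/eqP => xa; apply: not_end.
        by exists i => //; rewrite i_t.
      rewrite lt_neqAle xr // andbT; apply/eqP => xa; apply: not_end.
      by exists i.+1.
    have [_ K1e _] := int_opt i x K1 it intx opt1.
    have [_ K2e _] := int_opt i x K2 it intx opt2.
    by apply: neqK; rewrite K1e.
  move=> [[//|i] it ->]; exists (G i), (G i.+1); split.
  - by apply: (qdsoG i _ (ltnW it)); apply: right_endpoint_piece.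
  - by apply: (qdsoG i.+1 _ it); apply: left_endpoint_piece.
  - rewrite !cardG // 1?ltnW //; apply/eqP; rewrite gtn_eqF //; exact: e_decr.
do 3 (split=> //).
split.
  have [GH Gcard _] := optG 0%N isT.
  by apply/eqP; rewrite eqEcard GH Gcard e0 leqnn.
split; first by apply/cards0_eq; rewrite cardG // et.
split.
  by move=> i it; have [GH Gcard _] := optG i it; split=> // x; apply: qdsoG.
split; first exact: qdso_max_convex.
split.
  split; first exact: piece_cover.
  exists (fun i => - (2 * (e i)%:R)), (fun i => (sds_max H (e i))%:R).
  split=> [i x it ax|i j it jt]; first by rewrite (value_line i x) //; ring.
  move=> /oppr_inj/(mulfI _)/eqP; rewrite pnatr_eq0 eqr_nat => /(_ isT)/eqP eij.
  by case: (ltngtP i j) => // ij; [have := e_decr2 i j|have := e_decr2 j i];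
    rewrite ij ?it ?jt eij ltnn => /(_ isT).
move=> i it; split=> x ax.
  split; first exact: value_line.
  by move=> K; apply: (sds_optimal_qdso_optimal simpleH (top i it)).
move=> K optK; have optK' := int_opt i x K it ax optK.
by split=> //; case: optK'.
Qed.
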